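(* Let $0 \le a < b$ be real numbers and let $f:[a,b]\to\mathbb{R}$ be a differentiable function on $[a,b]$ such that $f'\in L_p[a,b]$, where $p>1$ and $\frac1p+\frac1q=1$, and let $\alpha\ge 0$. Then $$\left|\Gamma(\alpha+1)\,J_a^{\alpha}f(b)-(b-a)^{\alpha-1}\int_a^b f(s)\,ds\right|\le (b-a)^{\alpha+\frac1q}\left(\frac{1}{(\alpha q+1)^{1/q}}+\frac{1}{(q+1)^{1/q}}\right)\|f'\|_p .$$
   Context: For $a\ge 0$, the Riemann-Liouville fractional integral operator of order $\alpha\ge 0$ is defined by $$J_a^{\alpha}f(x)=\frac{1}{\Gamma(\alpha)}\int_a^x (x-t)^{\alpha-1}f(t)\,dt\quad(\alpha>0),\qquad J_a^{0}f(x)=f(x),$$ where $\Gamma$ is the Gamma function. The norm is $\|f'\|_p=\left(\int_a^b|f'(s)|^p\,ds\right)^{1/p}$. *)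

(* Defs.v *)
From HB Require Import structures.
From mathcomp Require Import all_boot all_order all_algebra.
From mathcomp Require Import all_classical all_reals all_analysis.

Set Implicit Arguments.
Unset Strict Implicit.
Unset Printing Implicit Defensive.

Import Order.TTheory GRing.Theory Num.Theory.
Import numFieldNormedType.Exports.

Local Open Scope classical_set_scope.
Local Open Scope ring_scope.

(* Differentiability relative to a set A: difference quotients are taken only
   at points of A, so that at an endpoint of A = `[a, b] the derivative is
   one-sided and the values of f outside A are irrelevant on A. The library's
   [derivable f x 1] would be two-sided at a and b. *)
Definition diff_quot (R : realType) (f : R -> R) (x y : R) : R :=
  (f y - f x) / (y - x).

Definition derivable_on (R : realType) (A : set R) (f : R -> R) : Prop :=
  forall x, A x -> cvg (diff_quot f x y @[y --> within A x^']).

Definition derive_on (R : realType) (A : set R) (f : R -> R) (x : R) : R :=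
  lim (diff_quot f x y @[y --> within A x^']).

(* Euler's integral; meaningful for 0 < z, where it converges. *)
Definition Gamma (R : realType) (z : R) : R :=
  \int[lebesgue_measure]_(t in `]0, +oo[) (t `^ (z - 1) * expR (- t)).

(* Meaningful for 0 <= alpha and a <= x. The integrand takes the value 0
   at the single point t = x when alpha < 1, as 0 `^ r = 0 for r <> 0. *)
Definition RL_integral (R : realType) (a alpha : R) (f : R -> R) (x : R) : R :=
  if alpha == 0 then f x
  else (Gamma alpha)^-1 *
    \int[lebesgue_measure]_(t in `[a, x]) ((x - t) `^ (alpha - 1) * f t).

(* L_p[a, b] is L_p(R) applied to the extension by zero outside [a, b]. *)
Definition in_Lp_itv (R : realType) (p a b : R) (g : R -> R) : Prop :=
  g \_ `[a, b] \in Lfun (@lebesgue_measure R) p%:E.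

(* Meaningful under [in_Lp_itv p a b g], which makes the norm finite. *)
Definition Lp_norm_itv (R : realType) (p a b : R) (g : R -> R) : R :=
  fine ('N[@lebesgue_measure R]_p%:E[EFin \o (g \_ `[a, b])]).

(* Main.v *)
Require Import Defs.
From HB Require Import structures.
From mathcomp Require Import all_boot all_order all_algebra.
From mathcomp Require Import all_classical all_reals all_analysis.
From mathcomp Require Import measurable_realfun ring lra.

Set Implicit Arguments.
Unset Strict Implicit.
Unset Printing Implicit Defensive.

Import Order.TTheory GRing.Theory Num.Theory.
Import numFieldNormedType.Exports.

Local Open Scope classical_set_scope.
Local Open Scope ring_scope.

(** For alpha > 0, put k(t) = alpha (b - t)^(alpha - 1), whose integral over [a, b] is
    (b - a)^alpha.  Since Gamma(alpha + 1) = alpha Gamma(alpha), the first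
    term of the theorem is the integral of k f, so subtracting (b - a)^alpha f(a)
    leaves the integral of k(t) (f(t) - f(a)).  As |f(t) - f(a)| is at most the
    integral of |f'| over [a, t], exchanging the integrals bounds this
    difference by the integral of |f'(s)| (b - s)^alpha, and Hoelder's
    inequality by (b - a)^(alpha + 1/q) / (alpha q + 1)^(1/q) times the norm of
    f' ([RL_integral_deviation]).  The same estimate at order 1, multiplied by
    (b - a)^(alpha - 1), compares the plain integral of f with the same quantity
    (b - a)^alpha f(a), so the theorem follows by the triangle inequality.

    The delicate step is |f(t) - f(a)| <= integral of |f'|, because f' is only
    assumed to exist everywhere and to be integrable, so it need not be
    continuous.  It is [increment_le_integral]: group the points x where
    |f'(x)| lies between n e and (n + 1) e, cover each group by an open set U_n
    of almost the same measure, and let Phi(x, y) be the sum over n of (n + 2) e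
    times the measure of the part of U_n in ]x, y].  Then Phi is additive in the
    interval, dominates the increments of f near every point, and has total mass
    close to the integral of |f'|; [interval_induction] turns the local
    domination into a global one.

    The Gamma recurrence is proved by the same exchange of integrals
    ([tonelli_triangle]), from t^alpha = integral of alpha s^(alpha - 1) over
    ]0, t[ and e^(-s) = integral of e^(-t) over ]s, +oo[. *)

Local Notation mu := lebesgue_measure.

(** * From local to global estimates on an interval *)

(** The principle behind Cousin's lemma: a property of intervals that holds for
    all short intervals with a given endpoint x, and that is preserved by gluing,
    propagates to [a, b].  The supremum of the points reachable from a is
    reachable from the left, and can be passed unless it is b. *)
Lemma interval_induction (R : realType) (a b : R) (P : R -> R -> Prop) :
  a <= b ->
  (forall x y z, x <= y -> y <= z -> P x y -> P y z -> P x z) ->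
  (forall x, a <= x <= b -> exists2 d, 0 < d &
     forall y, a <= y <= b -> `|y - x| < d ->
       (y <= x -> P y x) /\ (x <= y -> P x y)) ->
  P a b.
Proof.
move=> ab Ptrans Ploc.
have Prefl x : a <= x <= b -> P x x.
  move=> xab; have [d d0 /(_ x xab)] := Ploc x xab.
  by rewrite subrr normr0 => /(_ d0)[/(_ (lexx x))].
pose S := [set x | a <= x <= b /\ P a x].
have Sa : S a by split; [rewrite lexx | apply: Prefl; rewrite lexx].
have Sub : has_sup S by split; [exists a | exists b => x [/andP[]]].
set s := sup S.
have as_ : a <= s by apply: ub_le_sup => //; case: Sub.
have sb : s <= b by apply: ge_sup; [exists a|move=> x [/andP[]]].
have sab : a <= s <= b by rewrite as_.
have [d d0 Pd] := Ploc s sab.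
have [z [zab Paz] sz] := sup_adherent d0 Sub.
have zs : z <= s by apply: ub_le_sup => //; case: Sub.
have Pas : P a s.
  apply: (Ptrans _ z) => //; first by case/andP: zab.
  apply: (Pd z zab _).1 => //.
  by rewrite ler0_norm ?subr_le0// opprB ltrBlDl -ltrBlDr.
move: sb; rewrite le_eqVlt => /predU1P[<-//|sb].
pose v := Num.min b (s + d / 2).
have sv : s < v by rewrite lt_min sb ltrDl divr_gt0.
have vab : a <= v <= b.
  by rewrite (le_trans as_ (ltW sv)) ge_min lexx.
have vs : v - s < d.
  rewrite ltrBlDl gt_min; apply/orP; right; lra.
suff /(ub_le_sup Sub.2) : S v by rewrite leNgt sv.
split=> //; apply: (Ptrans _ s) => //; first exact: ltW.
by apply: (Pd v vab _).2; [rewrite gtr0_norm// subr_gt0|exact: ltW].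
Qed.

(** A mean value inequality with an integral bound: g x plays the role of the
    local Lipschitz constant of f at x.  No continuity of g is available, so g is
    replaced by the sum of the functions equal to (n + 2) e on an open set U n
    around the level set E n; openness is what makes the bound valid on a whole
    neighbourhood of each point of E n. *)
Lemma increment_le_integral (R : realType) (a b : R) (f g : R -> R) :
  a <= b -> measurable_fun `[a, b] g ->
  (forall x, a <= x <= b -> 0 <= g x) ->
  (forall x, a <= x <= b -> forall e, 0 < e -> \forall y \near x,
     a <= y <= b -> `|f y - f x| <= (g x + e) * `|y - x|) ->
  (`|f b - f a|%:E <= \int[mu]_(x in `[a, b]) (g x)%:E)%E.
Proof.
move=> ab mg g0 fg.
have muab : mu `[a, b]%classic = (b - a)%:E.
  rewrite lebesgue_measure_itv/= lte_fin; case: ltgtP ab => // [->] _.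
  by rewrite subrr.
(* Rounding g up on the level sets costs 2 e (b - a), and enlarging these to open
   sets costs e. *)
suff H e : 0 < e ->
    (`|f b - f a|%:E <= \int[mu]_(x in `[a, b]) (g x)%:E
                        + (2 * e * (b - a))%:E + e%:E)%E.
  apply/lee_addgt0Pr => e e0.
  have d0 : 0 < 2 * (b - a) + 1 by lra.
  have /H : 0 < e / (2 * (b - a) + 1) by rewrite divr_gt0.
  rewrite -addeA -EFinD; congr (_ <= _ + _%:E)%E.
  by field; rewrite gt_eqF.
move=> e0.
pose E n := `[a, b]%classic `&` g @^-1` `[n%:R * e, n.+1%:R * e[.
have mE n : measurable (E n) by exact: mg.
have EI : \bigcup_n E n = `[a, b]%classic.
  apply/seteqP; split=> [x [n _ []]//|x xab].
  exists (Num.truncn (g x / e)) => //; split => //=.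
  have /truncn_itv : 0 <= g x / e.
    by rewrite divr_ge0 ?(ltW e0)// g0//; move: xab; rewrite /= in_itv.
  by rewrite in_itv/= ler_pdivlMr// ltr_pdivrMr.
have tE : trivIset setT E.
  move=> i j _ _ [x [[_ /= +] [_ /=]]].
  rewrite !in_itv/= -!ler_pdivlMr// -!ltr_pdivrMr//.
  by move=> /truncn_def <- /truncn_def <-.
pose w n : R := n.+2%:R * e.
have w0 n : 0 < w n by rewrite mulr_gt0.
have muE n : (mu (E n) < +oo)%E.
  apply: (@le_lt_trans _ _ (mu `[a, b]%classic)); last by rewrite muab ltry.
  by apply: le_measure; rewrite ?inE//; [exact: mE|exact: subIsetl].
(* The tolerance for U n is such that, weighted by w n, the excesses of all the
   U n add up to at most e. *)
have [U /all_and3[oU EU Ue]] : exists U : nat -> set R, forall n,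
    [/\ open (U n), E n `<=` U n &
        (mu (U n `\` E n) < (e / (2 ^ n.+1)%:R / w n)%:E)%E].
  suff /choice[U HU] : forall n, exists Un : set R, [/\ open Un, E n `<=` Un &
      (mu (Un `\` E n) < (e / (2 ^ n.+1)%:R / w n)%:E)%E] by exists U.
  move=> n; apply: lebesgue_regularity_outer; [exact: mE|exact: muE|].
  by rewrite !divr_gt0// ltr0n expn_gt0.
have mU n : measurable (U n) by exact: open_measurable.
have mUE n : measurable (U n `\` E n) by exact: measurableD.
have mEU n : measurable (E n `|` (U n `\` E n)) by exact: measurableU.
have mUI n x y : measurable (U n `&` `]x, y]%classic) by exact: measurableI.
have mUU n x y z :
    measurable ((U n `&` `]x, y]%classic) `|` (U n `&` `]y, z]%classic)).
  by apply: measurableU; exact: mUI.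
pose Phi x y := (\sum_(0 <= n <oo) (w n)%:E * mu (U n `&` `]x, y]%classic))%E.
have wmu0 n A : (0 <= (w n)%:E * mu A)%E by rewrite mule_ge0// lee_fin ltW.
have Phi_loc n x y : x <= y -> `]x, y] `<=` U n ->
    ((w n * (y - x))%:E <= Phi x y)%E.
  move=> xy xyU; rewrite /Phi (@nneseriesD1 _ _ n)//.
  rewrite setIidr// lebesgue_measure_itv/= lte_fin.
  rewrite -[leLHS]adde0 leeD ?nneseries_ge0//.
  case: ltgtP xy => // [->] _.
  by rewrite subrr mulr0 mule0.
have Phi_tot : (Phi a b <= \int[mu]_(x in `[a, b]) (g x)%:E
                        + (2 * e * (b - a))%:E + e%:E)%E.
  have mg2 : measurable_fun `[a, b] (fun x => (g x + 2 * e)%:E).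
    by apply/measurable_EFinP; exact: measurable_funD.
  have g20 x : `[a, b]%classic x -> (0 <= (g x + 2 * e)%:E)%E.
    rewrite /= in_itv/= => xab; rewrite lee_fin addr_ge0 ?g0//.
    by rewrite mulr_ge0// ltW.
  have Sub n : E n `<=` `[a, b]%classic by exact: subIsetl.
  have -> : (\int[mu]_(x in `[a, b]) (g x)%:E + (2 * e * (b - a))%:E =
      \sum_(0 <= n <oo) \int[mu]_(x in E n) (g x + 2 * e)%:E)%E.
    rewrite -ge0_integral_bigcup//= EI//.
    under [RHS]eq_integral do rewrite EFinD.
    rewrite ge0_integralD//=; last 2 first.
    - exact/measurable_EFinP.
    - by move=> x _; rewrite lee_fin mulr_ge0// ltW.
    by rewrite integral_cst//= muab EFinM.
  apply: le_trans (epsilon_trick xpredT _ (ltW e0)); last first.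
    by move=> n; apply: integral_ge0 => x /Sub/g20.
  apply: lee_nneseries => // n _.
  apply: (@le_trans _ _ ((w n)%:E * (mu (E n) + mu (U n `\` E n))))%E.
    rewrite lee_pmul2l ?lte_fin//.
    apply: (@le_trans _ _ (mu (E n `|` (U n `\` E n)))).
      apply: le_measure; rewrite ?inE//.
      - exact: mUI.
      - exact: mEU.
      - by move=> x [Ux _]; have [|] := pselect (E n x); [left|right].
    by apply: measureU2; [exact: mE|exact: mUE].
  rewrite ge0_muleDr// leeD//; last first.
    by rewrite -lee_pdivlMl// muleC ltW// -EFinM.
  rewrite -integral_cst; last exact: mE.
  apply: ge0_le_integral => //=.
  - exact: mE.
  - by move=> x _; rewrite lee_fin ltW.
  - by apply: measurable_funS mg2.
  - move=> x [_ /=]; rewrite in_itv/= => /andP[nx _].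
    by rewrite lee_fin /w -addn2 natrD mulrDl lerD2r.
apply: le_trans Phi_tot.
apply: (@interval_induction R a b (fun x y => `|f y - f x|%:E <= Phi x y)%E) => //.
  move=> x y z xy yz Pxy Pyz.
  apply: (@le_trans _ _ (Phi x y + Phi y z)%E).
    apply: le_trans (leeD Pxy Pyz); rewrite -EFinD lee_fin.
    by rewrite (_ : f z - f x = f y - f x + (f z - f y)) ?ler_normD//; ring.
  rewrite /Phi -nneseriesD//; apply: lee_nneseries => // [n _ _|n _].
    by rewrite adde_ge0.
  rewrite -ge0_muleDr// lee_pmul2l ?lte_fin//.
  rewrite -measureU; [|exact: mUI|exact: mUI|].
    apply: le_measure; rewrite ?inE//; [exact: mUU|exact: mUI|].
    move=> t /= [] [Ut]; rewrite !in_itv/= => /andP[h1 h2].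
      by split=> //; rewrite h1 (le_trans h2).
    by split=> //; rewrite h2 (le_lt_trans xy h1).
  rewrite -subset0 => t [[_ /=]]; rewrite in_itv/= => /andP[_ ty] [_ /=].
  by rewrite in_itv/= ltNge ty.
move=> x xab.
have [n _ Enx] : (\bigcup_n E n) x by rewrite EI /= in_itv.
have /nbhs_ballP[d1 /= d10 H1] := fg x xab e e0.
have /nbhs_ballP[d2 /= d20 H2] := open_nbhs_nbhs (conj (oU n) (EU n x Enx)).
exists (Num.min d1 d2); first by rewrite lt_min d10.
move=> y yab; rewrite lt_min => /andP[yx1 yx2].
have fyx : `|f y - f x| <= w n * `|y - x|.
  apply: (le_trans (H1 y _ yab)); first by rewrite -ball_normE/= distrC.
  rewrite ler_wpM2r// /w -(addn1 n.+1) natrD mulrDl mul1r lerD2r ltW//.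
  by case: Enx => _ /=; rewrite in_itv/= => /andP[].
have Un_ball t : `|t - x| <= `|y - x| -> U n t.
  by move=> tx; apply: H2; rewrite -ball_normE/= distrC (le_lt_trans tx).
split=> xy.
  have yxE : `|y - x| = x - y by rewrite ler0_norm ?subr_le0// opprB.
  apply: (le_trans _ (Phi_loc n _ _ xy _)).
    by rewrite lee_fin distrC -yxE.
  move=> t /=; rewrite in_itv/= => /andP[yt tx]; apply: Un_ball.
  by rewrite yxE ler0_norm ?subr_le0// opprB lerD2l lerN2 ltW.
have yxE : `|y - x| = y - x by rewrite ger0_norm ?subr_ge0.
apply: (le_trans _ (Phi_loc n _ _ xy _)); first by rewrite lee_fin -yxE.
move=> t /=; rewrite in_itv/= => /andP[/ltW xt ty]; apply: Un_ball.
by rewrite yxE ger0_norm ?subr_ge0// lerD2r.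
Qed.

(** * Integrals of powers *)

(** Improper form of the fundamental theorem of calculus: the integrand may be
    singular at both ends, as powers with exponent in ]-1, 0[ are.  It is the
    monotone limit of the theorem on compact subintervals. *)
Lemma ge0_FTC_oo (R : realType) (f F : R -> R) (c d : R) : c < d ->
  (forall x, c < x < d -> 0 <= f x) ->
  (forall x, c < x < d -> is_derive x 1 F (f x)) ->
  (forall x, c < x < d -> {for x, continuous f}) ->
  F x @[x --> c^'+] --> F c -> F x @[x --> d^'-] --> F d ->
  (\int[mu]_(x in `]c, d[) (f x)%:E = (F d - F c)%:E)%E.
Proof.
move=> cd f0 dF cf Fc Fd.
(* A third of the length, so that even the first interval I 0 is nondegenerate. *)
pose h n : R := (d - c) / 3 * harmonic n.
have h0 n : 0 < h n by rewrite mulr_gt0 ?harmonic_gt0// divr_gt0// subr_gt0.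
have h3 n : h n <= (d - c) / 3.
  rewrite /h ler_piMr ?divr_ge0 ?subr_ge0 ?(ltW cd)//.
  by rewrite /harmonic invf_le1// ler1n.
have hcvg : h n @[n --> \oo] --> 0.
  rewrite -(mulr0 ((d - c) / 3)); apply: cvgM; first exact: cvg_cst.
  exact: cvg_harmonic.
have hnd : {homo h : m n / (m <= n)%N >-> n <= m}.
  move=> m n mn; rewrite /h ler_wpM2l ?divr_ge0 ?subr_ge0 ?(ltW cd)//.
  by rewrite /harmonic lef_pV2 ?posrE// ler_nat ltnS.
pose I n := `[c + h n, d - h n]%classic.
have Icd n x : I n x -> c < x < d.
  rewrite /I /= in_itv/= => /andP[cx xd]; have := h0 n; lra.
have IU : \bigcup_n I n = `]c, d[%classic.
  apply/seteqP; split=> [x [n _ /Icd]|x /=]; first by rewrite /= in_itv.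
  rewrite in_itv/= => /andP[cx xd].
  have e0 : 0 < Num.min (x - c) (d - x) by rewrite lt_min !subr_gt0 cx.
  move/cvgr0Pnorm_lt : hcvg => /(_ _ e0)[n _ /(_ n (leqnn n))].
  rewrite gtr0_norm// lt_min => /andP[hc hd].
  by exists n => //; rewrite /I /= in_itv/=; apply/andP; split; lra.
have cfn n : {within I n, continuous f}.
  apply: continuous_in_subspaceT => x; rewrite inE => /Icd; exact: cf.
have mI n : measurable (I n) by exact: measurable_itv.
have FI n : (\int[mu]_(x in I n) (f x)%:E)%E = (F (d - h n) - F (c + h n))%:E.
  rewrite EFinB (@continuous_FTC2 _ f F)//.
  - by have := h3 n; have := h0 n; lra.
  - exact: cfn.
  - have cF x : c < x < d -> {for x, continuous F}.
      by move=> /dF[dFx _]; apply/differentiable_continuous/derivable1_diffP.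
    split.
    + move=> x xI; have /Icd/dF[] // : I n x.
      by move: xI; rewrite /I /= !in_itv/= => /andP[/ltW -> /ltW ->].
    + by apply: cvg_at_right_filter; apply: cF; have := h3 n; have := h0 n; lra.
    + by apply: cvg_at_left_filter; apply: cF; have := h3 n; have := h0 n; lra.
  - move=> x xI; rewrite derive1E.
    have /Icd/dF[_ ->] // : I n x.
    by move: xI; rewrite /I /= !in_itv/= => /andP[/ltW -> /ltW ->].
have ndI : nondecreasing_seq I.
  move=> m n mn; apply/subsetPset => x; rewrite /I /= !in_itv/=.
  by have := hnd _ _ mn; move=> hmn /andP[? ?]; apply/andP; split; lra.
have mfI n : measurable_fun (I n) (EFin \o f).
  by apply/measurable_EFinP; exact: subspace_continuous_measurable_fun.
have f0I n x : I n x -> (0 <= (EFin \o f) x)%E.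
  by move=> /Icd/f0; rewrite lee_fin.
have := @ge0_nondecreasing_set_cvg_integral _ (measurableTypeR R) R
  I (EFin \o f) mu ndI mI mfI f0I.
rewrite IU => /cvg_lim <-//; apply/cvg_lim => //.
under eq_fun do rewrite FI.
apply: cvg_EFin; first exact: nearW.
apply: cvgB.
- move/cvg_at_leftP : Fd; apply; split; first by move=> n; rewrite ltrBlDr ltrDl.
  by rewrite -[X in _ --> X]subr0; apply: cvgB => //; exact: cvg_cst.
- move/cvg_at_rightP : Fc; apply; split; first by move=> n; rewrite ltrDl.
  by rewrite -[X in _ --> X]addr0; apply: cvgD => //; exact: cvg_cst.
Qed.

Lemma continuous_powR_gt0 (R : realType) (al x : R) : 0 < x ->
  {for x, continuous (@powR R ^~ al)}.
Proof.
by move=> x0; apply/differentiable_continuous/derivable1_diffP/derivable_powR;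
  rewrite in_itv/= x0.
Qed.

Lemma integral_powR (R : realType) (al t : R) : 0 < al -> 0 < t ->
  (\int[mu]_(s in `]0%R, t[) (al * s `^ (al - 1))%:E = (t `^ al)%:E)%E.
Proof.
move=> al0 t0.
have dF x : 0 < x < t -> is_derive x 1 (@powR R ^~ al) (al * x `^ (al - 1)).
  by move=> /andP[x0 _]; exact: is_derive1_powR.
rewrite (ge0_FTC_oo t0 _ dF)//.
- by rewrite powR0 ?subr0// gt_eqF.
- by move=> x _; rewrite mulr_ge0 ?powR_ge0// ltW.
- move=> x /andP[x0 _]; apply: cvgM; first exact: cvg_cst.
  exact: continuous_powR_gt0.
- by rewrite powR0 ?gt_eqF//; exact: powR_cvg0.
- by apply: cvg_at_left_filter; exact: continuous_powR_gt0.
Qed.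

Lemma measurable_powR_subl (R : realType) (b r : R) (D : set R) :
  measurable_fun D (fun t => (b - t) `^ r).
Proof.
apply: measurable_funTS; apply: (measurableT_comp (measurable_powR _)).
exact: measurable_funB.
Qed.

Lemma integral_powR_subl (R : realType) (al s b : R) : 0 < al -> s <= b ->
  (\int[mu]_(t in `[s, b]) (al * (b - t) `^ (al - 1))%:E
     = ((b - s) `^ al)%:E)%E.
Proof.
move=> al0; rewrite le_eqVlt => /predU1P[->|sb].
  by rewrite set_itv1 integral_set1 subrr powR0// gt_eqF.
have mk : measurable_fun [set: R] (fun t => (al * (b - t) `^ (al - 1))%:E).
  by apply/measurable_EFinP/measurable_funM => //; exact: measurable_powR_subl.
rewrite (@integral_itv_bndoo R s b _ true false); last exact: measurable_funTS.
have dF x : s < x < b ->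
    is_derive x 1 (fun t => - (b - t) `^ al) (al * (b - x) `^ (al - 1)).
  move=> /andP[_ xb].
  have bx : 0 < b - x by rewrite subr_gt0.
  have db : is_derive x 1 (fun t => b - t) (- 1).
    by apply: is_derive_eq; rewrite add0r mul1r.
  have dp := @is_derive1_comp R (@powR R ^~ al) (fun t => b - t) x
    _ _ (is_derive1_powR al bx) db.
  by apply: is_derive_eq; rewrite mulrN1 opprK.
rewrite (ge0_FTC_oo sb _ dF)//.
- by rewrite subrr powR0 ?gt_eqF// oppr0 add0r opprK.
- by move=> x _; rewrite mulr_ge0 ?powR_ge0// ltW.
- move=> x /andP[_ xb]; apply: cvgM; first exact: cvg_cst.
  apply: (@continuous_comp _ _ _ (fun t => b - t) (@powR R ^~ (al - 1))).
    by apply: cvgB; [exact: cvg_cst|exact: cvg_id].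
  by apply: continuous_powR_gt0; rewrite subr_gt0.
- apply: cvg_at_right_filter; apply: cvgN.
  apply: (@continuous_comp _ _ _ (fun t => b - t) (@powR R ^~ al)).
    by apply: cvgB; [exact: cvg_cst|exact: cvg_id].
  by apply: continuous_powR_gt0; rewrite subr_gt0.
- apply/cvg_at_leftP => u [ub ucvg]; apply: cvgN.
  rewrite subrr powR0 ?gt_eqF//.
  have /cvg_at_rightP := powR_cvg0 al0; apply; split.
    by move=> n; rewrite subr_gt0.
  by rewrite -(subrr b); apply: cvgB => //; exact: cvg_cst.
Qed.

(** * Exchange of integrals over a triangle *)

(** Both sides are the integral of u(t) v(s) over the half-plane s < t. *)
Lemma tonelli_triangle (R : realType) (u v : R -> \bar R) :
  measurable_fun setT u -> measurable_fun setT v ->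
  (forall t, 0 <= u t)%E -> (forall s, 0 <= v s)%E ->
  (\int[mu]_t (u t * \int[mu]_(s in `]-oo, t[) v s)
   = \int[mu]_s (v s * \int[mu]_(t in `]s, +oo[) u t))%E.
Proof.
move=> mesu mesv u0 v0.
pose T := measurableTypeR R.
pose k (z : T * T) := (if (z.2 < z.1)%R then u z.1 * v z.2 else 0)%E.
have mk : measurable_fun setT k.
  apply: measurable_fun_ifT => //.
    by apply: measurable_fun_ltr.
  by apply: emeasurable_funM; exact: measurableT_comp.
have k0 z : (0 <= k z)%E by rewrite /k; case: ifP => // _; exact: mule_ge0.
have := @fubini_tonelli _ _ T T R mu mu k mk k0.
have -> : (\int[mu]_x \int[mu]_y k (x, y)
   = \int[mu]_t (u t * \int[mu]_(s in `]-oo, t[) v s))%E.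
  apply: eq_integral => t _.
  rewrite -ge0_integralZl//; last exact: measurable_funTS.
  rewrite [RHS]integral_mkcond; apply: eq_integral => s _.
  by rewrite /k patchE mem_setE in_itv.
move->; apply: eq_integral => s _.
rewrite -ge0_integralZl//; last exact: measurable_funTS.
rewrite [RHS]integral_mkcond; apply: eq_integral => t _.
by rewrite /k patchE mem_setE in_itv/= andbT muleC.
Qed.

Lemma tonelli_triangle_on (R : realType) (D : set R) (u v : R -> \bar R) :
  measurable D -> measurable_fun D u -> measurable_fun D v ->
  (forall t, D t -> 0 <= u t)%E -> (forall s, D s -> 0 <= v s)%E ->
  (\int[mu]_(t in D) (u t * \int[mu]_(s in `]-oo, t[ `&` D) v s)
   = \int[mu]_(s in D) (v s * \int[mu]_(t in `]s, +oo[ `&` D) u t))%E.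
Proof.
move=> mD mesu mesv u0 v0.
have := @tonelli_triangle R (u \_ D) (v \_ D).
move=> /(_ (iffLR (measurable_restrictT _ mD) mesu)).
move=> /(_ (iffLR (measurable_restrictT _ mD) mesv)).
move=> /(_ (erestrict_ge0 u0) (erestrict_ge0 v0)) H.
rewrite [LHS]integral_mkcond [RHS]integral_mkcond.
transitivity (\int[mu]_t ((u \_ D) t * \int[mu]_(s in `]-oo, t[) (v \_ D) s))%E.
  apply: eq_integral => t _; rewrite patchE [in RHS]patchE.
  by case: ifP => _; [rewrite integral_mkcondr|rewrite mul0e].
rewrite H; apply: eq_integral => s _; rewrite patchE [in RHS]patchE.
by case: ifP => _; [rewrite integral_mkcondr|rewrite mul0e].
Qed.

Lemma measurable_integral_itvNy (R : realType) (D : set R) (v : R -> \bar R) :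
  measurable D -> measurable_fun D v -> (forall s, D s -> 0 <= v s)%E ->
  measurable_fun [set: R] (fun t : R => \int[mu]_(s in `]-oo, t[ `&` D) v s)%E.
Proof.
move=> mD mesv v0; pose T := measurableTypeR R.
pose k (z : T * T) := (if (z.2 < z.1)%R then (v \_ D) z.2 else 0)%E.
have mk : measurable_fun setT k.
  apply: measurable_fun_ifT => //; first exact: measurable_fun_ltr.
  apply: measurableT_comp => //; exact: (iffLR (measurable_restrictT _ mD)).
have k0 z : (0 <= k z)%E by rewrite /k; case: ifP => // _; exact: erestrict_ge0.
have := @measurable_fun_fubini_tonelli_F _ _ T T R mu k mk k0.
apply: eq_measurable_fun => t _; rewrite /fubini_F integral_mkcondr.
rewrite [RHS]integral_mkcond; apply: eq_integral => s _.
by rewrite /k [in RHS]patchE mem_setE in_itv.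
Qed.

(** * The Gamma function *)

Lemma integral_expR_tail (R : realType) (r s : R) : 0 < r ->
  (\int[mu]_(t in `]s, +oo[) (r * expR (- (r * t)))%:E
     = (expR (- (r * s)))%:E)%E.
Proof.
move=> r0.
have dE (x : R) :
    is_derive x 1 (fun t : R => - expR (- (r * t))) (r * expR (- (r * x))).
  have dl : is_derive x 1 (fun t : R => - (r * t)) (- r).
    by apply: is_derive_eq; rewrite scaler1.
  have dc := @is_derive1_comp R expR (fun t => - (r * t)) x _ _
    (is_derive_expR _) dl.
  by apply: is_derive_eq; rewrite mulrN opprK mulrC.
have cE : continuous (fun t : R => - expR (- (r * t))).
  move=> x; case: (dE x) => dx _.
  exact/differentiable_continuous/derivable1_diffP.
have mE : continuous (fun t : R => r * expR (- (r * t))).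
  move=> x; apply: cvgM; first exact: cvg_cst.
  rewrite -[X in _ --> X]opprK.
  under eq_cvg do rewrite -[expR _]opprK.
  by apply: cvgN; exact: cE.
rewrite integral_itv_obnd_cbnd; last first.
  apply/measurable_EFinP/measurable_funTS; exact: continuous_measurable_fun.
rewrite (@ge0_continuous_FTC2y R _ (fun t => - expR (- (r * t))) s 0)//.
- by rewrite EFinN oppeK add0e.
- by move=> x _; rewrite mulr_ge0 ?expR_ge0// ltW.
- exact: continuous_subspaceT.
- rewrite -oppr0; apply: cvgN.
  apply: (@cvg_comp _ _ _ (fun t => r * t) (fun z => expR (- z)) _ (pinfty_nbhs R)).
    by apply: gt0_cvgMry => //; exact: cvg_id.
  exact: cvgr_expR.
- by apply: cvg_at_right_filter; exact: cE.
- by move=> x _; rewrite derive1E; case: (dE x).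
Qed.

(** Euler's integral as an extended real, so that the recurrence can be stated
    before the integral is known to converge. *)
Definition EGamma (R : realType) (z : R) : \bar R :=
  (\int[mu]_(t in `]0%R, +oo[) (t `^ (z - 1) * expR (- t))%:E)%E.

Lemma measurable_Gamma_integrand (R : realType) (z : R) (D : set R) :
  measurable_fun D (fun t => (t `^ (z - 1) * expR (- t))%:E).
Proof.
apply/measurable_EFinP; apply: measurable_funTS; apply: measurable_funM => //.
exact: measurableT_comp.
Qed.

(** Expanding t^al as the integral of al s^(al - 1) over ]0, t[ and exchanging
    the integrals replaces the integration by parts; since everything is
    nonnegative, no convergence has to be known beforehand. *)
Lemma EGammaD1 (R : realType) (al : R) : 0 < al ->
  EGamma (al + 1) = (al%:E * EGamma al)%E.
Proof.
move=> al0; rewrite /EGamma.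
have mE : measurable_fun [set: R] (fun t => (expR (- t))%:E).
  by apply/measurable_EFinP; exact: measurableT_comp.
have mP : measurable_fun [set: R] (fun t => (al * t `^ (al - 1))%:E).
  by apply/measurable_EFinP; apply: measurable_funM.
rewrite -ge0_integralZl//; last 3 first.
- exact: measurable_Gamma_integrand.
- by move=> t _; rewrite lee_fin mulr_ge0 ?powR_ge0 ?expR_ge0.
- by rewrite lee_fin ltW.
have E0 (t : R) : `]0, +oo[%classic t -> (0 <= (expR (- t))%:E)%E.
  by move=> _; rewrite lee_fin expR_ge0.
have P0 (t : R) : `]0, +oo[%classic t -> (0 <= (al * t `^ (al - 1))%:E)%E.
  by move=> _; rewrite lee_fin mulr_ge0 ?powR_ge0// ltW.
have H := @tonelli_triangle_on R _ _ _
  (measurable_itv _) (measurable_funTS mE) (measurable_funTS mP) E0 P0.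
transitivity (\int[mu]_(t in `]0%R, +oo[) ((expR (- t))%:E *
    \int[mu]_(s in `]-oo, t[ `&` `]0%R, +oo[) (al * s `^ (al - 1))%:E))%E.
  apply: eq_integral => t; rewrite inE/= in_itv/= andbT => t0.
  rewrite (_ : _ `&` _ = `]0, t[%classic) ?integral_powR//.
    by rewrite addrK -EFinM mulrC.
  apply/seteqP; split => s /=; rewrite !in_itv/= andbT; first by case=> -> ->.
  by case/andP=> -> ->.
rewrite H; apply: eq_integral => s; rewrite inE/= in_itv/= andbT => s0.
rewrite (_ : _ `&` _ = `]s, +oo[%classic); last first.
  apply/seteqP; split => t /=; rewrite !in_itv/= !andbT; first by case.
  by move=> st; split => //; exact: lt_trans st.
have := @integral_expR_tail R 1 s ltr01.
under eq_integral do rewrite !mul1r.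
by rewrite mul1r => ->; rewrite -!EFinM mulrA.
Qed.

(** From 1 + x <= e^x at x = t / (2 c), raised to the power c. *)
Lemma powR_le_expR (R : realType) (c t : R) : 0 < c -> 0 <= t ->
  t `^ c <= (2 * c) `^ c * expR (t / 2).
Proof.
move=> c0 t0; have d0 : 0 < 2 * c by rewrite mulr_gt0.
have -> : expR (t / 2) = expR (t / (2 * c)) `^ c.
  by rewrite -expRM; congr expR; field; rewrite gt_eqF.
rewrite -powRM ?expR_ge0 ?(ltW d0)//.
apply: ge0_ler_powR; rewrite ?nnegrE ?(ltW c0)//.
  by rewrite mulr_ge0 ?expR_ge0 ?(ltW d0).
rewrite -ler_pdivrMl// mulrC (le_trans _ (expR_ge1Dx _))//.
by rewrite lerDr.
Qed.

(** On ]0, 1[ the integrand is at most t^(z - 1); on [1, +oo[ it is at most a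
    multiple of e^(-t/2). *)
Lemma EGamma_lty (R : realType) (z : R) : 0 < z -> (EGamma z < +oo)%E.
Proof.
move=> z0; rewrite /EGamma.
have gE (t : R) : (0 <= (t `^ (z - 1) * expR (- t))%:E)%E.
  by rewrite lee_fin mulr_ge0 ?powR_ge0 ?expR_ge0.
have mP (D : set R) : measurable_fun D (fun t => (z * t `^ (z - 1))%:E).
  by apply/measurable_EFinP/measurable_funTS; exact: measurable_funM.
have mE (D : set R) : measurable_fun D (fun t => (2^-1 * expR (- (2^-1 * t)))%:E).
  apply/measurable_EFinP; apply: measurable_funM => //.
  by apply: measurableT_comp => //; exact: measurableT_comp.
have -> : `]0, +oo[%classic = `]0, 1[%classic `|` `[1, +oo[%classic :> set R.
  apply/seteqP; split=> t /=; rewrite !in_itv/= !andbT.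
    by move=> ->/=; case: ltP; [left|right].
  by case=> [/andP[]//|]; exact: lt_le_trans.
rewrite ge0_integral_setU//=; last 2 first.
- exact: measurable_Gamma_integrand.
- apply/disj_setPS => t /= []; rewrite !in_itv/= andbT => /andP[_ t1].
  by rewrite leNgt t1.
apply: lte_add_pinfty.
  apply: (@le_lt_trans _ _ (\int[mu]_(t in `]0%R, 1%R[)
      (z^-1%:E * (z * t `^ (z - 1))%:E)))%E.
    apply: ge0_le_integral => //=.
    - exact: measurable_Gamma_integrand.
    - by apply: emeasurable_funM => //; exact: mP.
    - move=> t; rewrite in_itv/= => /andP[t0 _].
      rewrite -EFinM lee_fin mulKf ?gt_eqF// ler_piMr ?powR_ge0//.
      by rewrite -expR0 ler_expR oppr_le0 ltW.
  rewrite ge0_integralZl//=; last 3 first.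
  - exact: mP.
  - by move=> t _; rewrite lee_fin mulr_ge0 ?powR_ge0// ltW.
  - by rewrite lee_fin invr_ge0 ltW.
  by rewrite integral_powR// -EFinM ltry.
(* Any positive c >= z - 1 would do. *)
pose c := `|z - 1| + 1.
have c0 : 0 < c by rewrite ltr_wpDl.
pose K := (2 * c) `^ c * 2.
apply: (@le_lt_trans _ _ (\int[mu]_(t in `[1%R, +oo[)
    (K%:E * (2^-1 * expR (- (2^-1 * t)))%:E)))%E.
  apply: ge0_le_integral => //=.
  - exact: measurable_Gamma_integrand.
  - by apply: emeasurable_funM => //; exact: mE.
  - move=> t; rewrite in_itv/= andbT => t1.
    have t0 : 0 <= t by rewrite (le_trans ler01).
    have -> : - t = - (2^-1 * t) - 2^-1 * t by lra.
    rewrite -EFinM lee_fin expRD !mulrA ler_wpM2r ?expR_ge0//.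
    rewrite /K mulfK// expRN ler_pdivrMr ?expR_gt0// [2^-1 * t]mulrC.
    apply: le_trans (powR_le_expR c0 t0); rewrite ler_powR//.
    by rewrite (le_trans (ler_norm _))// lerDl.
rewrite ge0_integralZl//=; last 2 first.
- exact: mE.
- by rewrite lee_fin mulr_ge0 ?powR_ge0.
rewrite -integral_itv_obnd_cbnd; last exact: mE.
by rewrite integral_expR_tail// -EFinM ltry.
Qed.

Lemma GammaE (R : realType) (z : R) : Gamma z = fine (EGamma z).
Proof. by []. Qed.

(** On ]0, 1[ the integrand is at least t^(z - 1) / e, whose integral is
    1 / (z e). *)
Lemma EGamma_gt0 (R : realType) (z : R) : 0 < z -> (0 < EGamma z)%E.
Proof.
move=> z0.
apply: (@lt_le_trans _ _ (expR (- 1) * z^-1)%:E).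
  by rewrite lte_fin mulr_gt0 ?expR_gt0 ?invr_gt0.
apply: (@le_trans _ _
  (\int[mu]_(t in `]0%R, 1%R[) (t `^ (z - 1) * expR (- t))%:E)%E); last first.
  apply: ge0_subset_integral => //=.
  - exact: measurable_Gamma_integrand.
  - by move=> t _; rewrite lee_fin mulr_ge0 ?powR_ge0 ?expR_ge0.
  - by move=> t /=; rewrite !in_itv/= andbT => /andP[].
have mP : measurable_fun (`]0, 1[%classic : set R)
    (fun t : R => (z * t `^ (z - 1))%:E).
  by apply/measurable_EFinP; apply: measurable_funM => //; exact: measurable_funTS.
have -> : (expR (- 1) * z^-1)%:E =
    (\int[mu]_(t in `]0%R, 1%R[) ((expR (- 1) * z^-1)%:E * (z * t `^ (z - 1))%:E))%E.
  rewrite ge0_integralZl//=.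
  - by rewrite integral_powR// powR1 mule1.
  - by move=> t _; rewrite lee_fin mulr_ge0 ?powR_ge0// ltW.
  - by rewrite lee_fin mulr_ge0 ?expR_ge0// invr_ge0 ltW.
apply: ge0_le_integral => //=.
- move=> t _; rewrite -EFinM lee_fin !mulr_ge0 ?expR_ge0 ?invr_ge0 ?powR_ge0//;
  exact: ltW.
- exact: emeasurable_funM.
- exact: measurable_Gamma_integrand.
- move=> t; rewrite in_itv/= => /andP[t0 t1].
  rewrite -EFinM lee_fin -mulrA mulKf ?gt_eqF// mulrC ler_wpM2l ?powR_ge0//.
  by rewrite ler_expR lerN2 ltW.
Qed.

Lemma EGamma_fin_num (R : realType) (z : R) : 0 < z -> EGamma z \is a fin_num.
Proof.
by move=> z0; rewrite ge0_fin_numE ?EGamma_lty//; exact/ltW/EGamma_gt0.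
Qed.

Lemma Gamma_gt0 (R : realType) (z : R) : 0 < z -> 0 < Gamma z.
Proof. by move=> z0; rewrite GammaE fine_gt0// EGamma_gt0// EGamma_lty. Qed.

Lemma GammaD1 (R : realType) (z : R) : 0 < z -> Gamma (z + 1) = z * Gamma z.
Proof. by move=> z0; rewrite !GammaE EGammaD1// fineM// EGamma_fin_num. Qed.

Lemma Gamma1 (R : realType) : Gamma 1 = 1 :> R.
Proof.
rewrite GammaE /EGamma.
transitivity (fine (\int[mu]_(t in `]0%R, +oo[) (1 * expR (- (1 * t)) : R)%:E)%E).
  congr fine; apply: eq_integral => t _.
  by rewrite subrr powRr0 !mul1r.
by rewrite integral_expR_tail// mulr0 oppr0 expR0.
Qed.

(** * Functions with derivative in L_p *)

Lemma derivable_on_growth (R : realType) (A : set R) (f : R -> R) (x e : R) :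
  derivable_on A f -> A x -> 0 < e -> \forall y \near x,
    A y -> `|f y - f x| <= (`|derive_on A f x| + e) * `|y - x|.
Proof.
move=> df Ax e0; have /cvgrPdist_le/(_ e e0) := df x Ax.
rewrite !near_withinE; apply: filterS => y H Ay.
have [->|yx] := eqVneq y x; first by rewrite !subrr normr0 mulr0.
have {}H : `|derive_on A f x - (f y - f x) / (y - x)| <= e := H yx Ay.
have yx0 : 0 < `|y - x| by rewrite normr_gt0 subr_eq0.
rewrite -ler_pdivrMr// -normf_div -lerBlDl.
by apply: le_trans H; rewrite distrC lerB_dist.
Qed.

Lemma derivable_on_continuous (R : realType) (A : set R) (f : R -> R) :
  derivable_on A f -> {within A, continuous f}.
Proof.
move=> df; apply/subspace_continuousP => x Ax.
apply/cvgrPdist_le => e e0; rewrite near_withinE.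
have M0 : 0 < `|derive_on A f x| + 1 by rewrite ltr_wpDl.
near=> y => Ay; rewrite distrC.
have /(_ Ay)/le_trans : A y ->
    `|f y - f x| <= (`|derive_on A f x| + 1) * `|y - x|.
  by near: y; exact: derivable_on_growth.
apply; rewrite -ler_pdivlMl// mulrC distrC.
near: y; apply: cvgr_dist_le; first exact: cvg_id.
by rewrite divr_gt0.
Unshelve. all: by end_near. Qed.

Lemma increment_le_integral_derive (R : realType) (a b t : R) (f : R -> R) :
  derivable_on `[a, b] f -> measurable_fun `[a, b] (derive_on `[a, b] f) ->
  a <= t <= b ->
  (`|f t - f a|%:E <=
     \int[mu]_(x in `[a, t]) `|derive_on `[a, b] f x|%:E)%E.
Proof.
move=> df mdf /andP[at_ tb].
have tab x : a <= x <= t -> `[a, b]%classic x.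
  by rewrite /= in_itv/= => /andP[-> xt]; exact: le_trans tb.
apply: increment_le_integral => //.
  by apply: measurableT_comp => //; apply: measurable_funS mdf.
move=> x xat e e0.
by apply: filterS (derivable_on_growth df (tab x xat) e0) => y H /tab.
Qed.

Lemma holder_conj_gt0 (R : realType) (p q : R) :
  1 < p -> 1 / p + 1 / q = 1 -> 0 < q.
Proof.
move=> p1 pq; have p0 : 0 < p by rewrite (lt_trans ltr01).
have : 0 < 1 / q.
  have -> : 1 / q = 1 - 1 / p by lra.
  by rewrite subr_gt0 div1r invf_lt1.
by rewrite div1r invr_gt0.
Qed.

(** Hoelder's inequality for g and the weight (b - s)^be, both extended by zero
    outside [a, b]; the L_q norm of the weight is explicit. *)
Lemma holder_weight (R : realType) (a b p q be : R) (g : R -> R) :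
  a < b -> 1 < p -> 1 / p + 1 / q = 1 -> 0 <= be -> in_Lp_itv p a b g ->
  (\int[mu]_(s in `[a, b]) (`|g s| * (b - s) `^ be)%:E <=
    ((b - a) `^ (be + 1 / q) / (be * q + 1) `^ (1 / q)
      * Lp_norm_itv p a b g)%:E)%E.
Proof.
move=> ab p1 pq be0 gLp.
have q0 := holder_conj_gt0 p1 pq.
have p0 : 0 < p by rewrite (lt_trans ltr01).
pose F := g \_ `[a, b].
pose k := (fun s : R => (b - s) `^ be) \_ `[a, b].
have [mF NF] : measurable_fun setT F /\ ('N[mu]_p%:E[EFin \o F] < +oo)%E.
  by move: gLp; rewrite /in_Lp_itv !inE => /andP[]; rewrite !inE.
have mk0 : measurable_fun [set: R] (fun s : R => (b - s) `^ be).
  exact: measurable_powR_subl.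
have mk : measurable_fun setT k.
  by apply: (iffLR (measurable_restrictT _ _)) => //; exact: measurable_funTS.
have be1 : 0 < be * q + 1 by rewrite ltr_wpDl// mulr_ge0// ltW.
have Nk : ('N[mu]_q%:E[EFin \o k] =
    ((b - a) `^ (be + 1 / q) / (be * q + 1) `^ (1 / q))%:E)%E.
  rewrite unlock /=.
  have -> : (\int[mu]_x (`|(k x)%:E| `^ q) =
     \int[mu]_(s in `[a, b]) ((be * q + 1)^-1%:E *
       ((be * q + 1) * (b - s) `^ (be * q + 1 - 1))%:E))%E.
    rewrite [RHS]integral_mkcond; apply: eq_integral => s _.
    rewrite /k !patchE; case: ifP => _ /=; last first.
      by rewrite normr0 powR0// gt_eqF.
    rewrite -EFinM addrK mulKf ?gt_eqF// ger0_norm ?powR_ge0//.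
    by rewrite ?poweR_EFin -powRrM.
  rewrite ge0_integralZl//=; last 3 first.
  - apply/measurable_EFinP/measurable_funTS; apply: measurable_funM => //.
    exact: measurable_powR_subl.
  - by move=> s _; rewrite lee_fin mulr_ge0 ?powR_ge0// ltW.
  - by rewrite lee_fin invr_ge0 ltW.
  rewrite integral_powR_subl ?(ltW ab)// -EFinM poweR_EFin; congr EFin.
  have ba : 0 < b - a by rewrite subr_gt0.
  rewrite powRM ?invr_ge0 ?powR_ge0 ?(ltW be1)// -powRrM div1r.
  rewrite mulrDl mul1r mulfK ?gt_eqF// mulrC; congr (_ * _).
  rewrite -powR_inv1 ?(ltW be1)// -powRN -powRrM; congr powR.
  by rewrite mulN1r.
have pq' : p^-1 + q^-1 = 1 by rewrite -pq !div1r.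
have := hoelder mu mF mk p0 q0 pq'.
rewrite Lnorm1 Nk -[X in (X * _)%E](@fineK _ 'N[mu]_p%:E[EFin \o F]); last first.
  by rewrite ge0_fin_numE// Lnorm_ge0.
rewrite -EFinM mulrC => /(le_trans _); apply.
rewrite le_eqVlt; apply/orP; left; apply/eqP.
rewrite [LHS]integral_mkcond; apply: eq_integral => s _; rewrite /F /k /= !patchE; case: ifP => _.
  by rewrite normrM (ger0_norm (powR_ge0 _ _)).
by rewrite mul0r normr0.
Qed.

Lemma in_Lp_itv_measurable (R : realType) (p a b : R) (g : R -> R) :
  in_Lp_itv p a b g -> measurable_fun `[a, b] g.
Proof.
rewrite /in_Lp_itv !inE => /andP[]; rewrite !inE => mg _.
exact: (iffRL (measurable_restrictT _ (measurable_itv _))).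
Qed.

(** Bounding |f t - f a| by the integral of |f'| over [a, t] and exchanging the
    integrals, the weight of |f'(s)| becomes the integral over [s, b] of
    al (b - t)^(al - 1), that is (b - s)^al. *)
Lemma integral_weighted_increment (R : realType) (a b p q al : R) (f : R -> R) :
  a < b -> 1 < p -> 1 / p + 1 / q = 1 -> 0 < al ->
  derivable_on `[a, b] f -> in_Lp_itv p a b (derive_on `[a, b] f) ->
  (\int[mu]_(t in `[a, b]) (al * (b - t) `^ (al - 1) * `|f t - f a|)%:E <=
    ((b - a) `^ (al + 1 / q) / (al * q + 1) `^ (1 / q)
      * Lp_norm_itv p a b (derive_on `[a, b] f))%:E)%E.
Proof.
move=> ab p1 pq al0 df Lp.
apply: le_trans (holder_weight ab p1 pq (ltW al0) Lp).
set g := derive_on `[a, b] f.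
have mg : measurable_fun `[a, b] g by exact: in_Lp_itv_measurable Lp.
have mw : measurable_fun [set: R] (fun t => al * (b - t) `^ (al - 1)).
  by apply: measurable_funM => //; exact: measurable_powR_subl.
have mf : measurable_fun `[a, b] f.
  apply: subspace_continuous_measurable_fun => //.
  exact: derivable_on_continuous.
pose u t := (al * (b - t) `^ (al - 1))%:E.
pose v s := `|g s|%:E.
have mesu : measurable_fun `[a, b] u.
  by apply/measurable_EFinP; exact: measurable_funTS.
have mesv : measurable_fun `[a, b] v.
  by apply/measurable_EFinP; exact: measurableT_comp.
have u0 t : `[a, b]%classic t -> (0 <= u t)%E.
  by move=> _; rewrite lee_fin mulr_ge0 ?powR_ge0// ltW.
have v0 s : `[a, b]%classic s -> (0 <= v s)%E by rewrite lee_fin.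
apply: (@le_trans _ _ (\int[mu]_(t in `[a, b])
    (u t * \int[mu]_(s in `]-oo, t[ `&` `[a, b]) v s))%E).
  apply: ge0_le_integral => //=.
  - by move=> t tab; rewrite lee_fin mulr_ge0// -lee_fin; exact: u0.
  - apply/measurable_EFinP; apply: measurable_funM; first exact: measurable_funTS.
    by apply: measurableT_comp => //; exact: measurable_funB.
  - apply: emeasurable_funM => //; apply: measurable_funTS.
    exact: measurable_integral_itvNy.
  - move=> t tab; rewrite EFinM lee_wpmul2l ?u0//.
    rewrite (_ : _ `&` _ = `[a, t[%classic); last first.
      move: tab; rewrite in_itv/= => /andP[_ tb].
      apply/seteqP; split => s /=; rewrite !in_itv/=.
        by case=> -> /andP[->].
      by case/andP=> -> st; split => //; rewrite (ltW (lt_le_trans st tb)).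
    have tab' : a <= t <= b by move: tab; rewrite in_itv.
    rewrite integral_itv_bndo_bndc; first exact: increment_le_integral_derive.
    apply: measurable_funS mesv => // s /=; rewrite !in_itv/= => /andP[-> st].
    by case/andP: tab' => _ /(lt_le_trans st)/ltW.
rewrite tonelli_triangle_on// le_eqVlt; apply/orP; left; apply/eqP.
apply: eq_integral => s; rewrite inE/= in_itv/= => /andP[as_ sb].
rewrite EFinM; congr (_ * _)%E.
rewrite (_ : _ `&` _ = `]s, b]%classic); last first.
  apply/seteqP; split => t /=; rewrite !in_itv/= andbT.
    by case=> -> /andP[].
  by case/andP=> st ->; rewrite st (le_trans as_ (ltW st)).
rewrite integral_itv_obnd_cbnd ?integral_powR_subl//.
apply: measurable_funTS; exact/measurable_EFinP.
Qed.

(** * The inequality *)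

(** For al > 0 the left-hand side is the integral of
    al (b - t)^(al - 1) (f t - f a); for al = 0 it is |f b - f a|, so that
    the exponent 0 in the Hoelder estimate gives the bound directly. *)
Lemma RL_integral_deviation (R : realType) (a b p q al : R) (f : R -> R) :
  a < b -> 1 < p -> 1 / p + 1 / q = 1 -> 0 <= al ->
  derivable_on `[a, b] f -> in_Lp_itv p a b (derive_on `[a, b] f) ->
  `| Gamma (al + 1) * RL_integral a al f b - (b - a) `^ al * f a | <=
    (b - a) `^ (al + 1 / q) / (al * q + 1) `^ (1 / q)
      * Lp_norm_itv p a b (derive_on `[a, b] f).
Proof.
move=> ab p1 pq + df Lp; rewrite /RL_integral le_eqVlt => /predU1P[<-|al0].
  rewrite eqxx.
  have -> : Gamma (0 + 1) * f b - (b - a) `^ 0 * f a = f b - f a.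
    by rewrite add0r Gamma1 powRr0 !mul1r.
  rewrite -lee_fin.
  have := holder_weight ab p1 pq (lexx 0) Lp; apply: le_trans.
  under eq_integral do rewrite powRr0 mulr1.
  apply: increment_le_integral_derive => //; last by rewrite lexx ltW.
  exact: in_Lp_itv_measurable Lp.
rewrite gt_eqF// GammaD1// mulrA mulfK ?gt_eqF ?Gamma_gt0//.
set I := `[a, b]%classic.
have mI : measurable (I : set (measurableTypeR R)) by exact: measurable_itv.
pose k t := al * (b - t) `^ (al - 1).
have mk : measurable_fun I k.
  by apply: measurable_funM => //; exact: measurable_powR_subl.
have k0 t : 0 <= k t by rewrite mulr_ge0 ?powR_ge0 ?ltW.
have mf : measurable_fun I f.
  apply: subspace_continuous_measurable_fun => //.
  exact: derivable_on_continuous.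
have bound := integral_weighted_increment ab p1 pq al0 df Lp.
have ik : mu.-integrable I (EFin \o k).
  apply/integrableP; split; first exact/measurable_EFinP.
  under eq_integral do rewrite /= ger0_norm ?k0//.
  by rewrite integral_powR_subl ?(ltW ab)// ltry.
(* The estimate on the increments also gives the integrability of the
   Riemann-Liouville integrand, by splitting f t into f t - f a and f a. *)
have ikd : mu.-integrable I (EFin \o (fun t => k t * (f t - f a))).
  apply/integrableP; split.
    by apply/measurable_EFinP; apply: measurable_funM => //; exact: measurable_funB.
  apply: le_lt_trans (ltry _); apply: le_trans bound.
  by under eq_integral do rewrite /= normrM (ger0_norm (k0 _)).
have ika : mu.-integrable I (EFin \o (fun t => k t * f a)).
  have := integrableZr mI (f a) ik.
  by apply: eq_integrable => // t _; rewrite /= EFinM.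
have ikf : mu.-integrable I (EFin \o (fun t => (b - t) `^ (al - 1) * f t)).
  have := integrableZl mI al^-1
    (integrableD mI ikd ika).
  apply: eq_integrable => // t _; rewrite /= -EFinD -EFinM; congr EFin.
  by rewrite /k; field; rewrite gt_eqF.
have -> : al * \int[mu]_(t in I) ((b - t) `^ (al - 1) * f t) - (b - a) `^ al * f a
    = \int[mu]_(t in I) (k t * (f t - f a)).
  have -> : (b - a) `^ al * f a = \int[mu]_(t in I) (k t * f a).
    rewrite RintegralZr//; congr (_ * _).
    by rewrite /Rintegral integral_powR_subl ?(ltW ab).
  rewrite -RintegralZl// -RintegralB//; last first.
    have := integrableZl mI al ikf.
    by apply: eq_integrable => // t _; rewrite /= EFinM.
  by apply: eq_Rintegral => t _; rewrite /k; ring.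
apply: le_trans (le_normr_Rintegral _ ikd) _ => //.
rewrite -lee_fin /Rintegral fineK; last first.
  by apply: integrable_fin_num => //; exact: integrable_norm.
apply: le_trans bound.
by under eq_integral do rewrite normrM (ger0_norm (k0 _)).
Qed.

Theorem theorem1 (R : realType) (a b p q alpha : R) (f : R -> R)
    (a_ge0 : 0 <= a) (ab : a < b)
    (f_diff : derivable_on `[a, b] f)
    (f'_Lp : in_Lp_itv p a b (derive_on `[a, b] f))
    (p_gt1 : 1 < p) (pq : 1 / p + 1 / q = 1)
    (alpha_ge0 : 0 <= alpha) :
  `| Gamma (alpha + 1) * RL_integral a alpha f b
     - (b - a) `^ (alpha - 1) * \int[lebesgue_measure]_(s in `[a, b]) f s |
  <= (b - a) `^ (alpha + 1 / q)
     * (1 / (alpha * q + 1) `^ (1 / q) + 1 / (q + 1) `^ (1 / q))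
     * Lp_norm_itv p a b (derive_on `[a, b] f).
Proof.
have ba0 : 0 < b - a by rewrite subr_gt0.
have Hal := RL_integral_deviation ab p_gt1 pq alpha_ge0 f_diff f'_Lp.
have := RL_integral_deviation ab p_gt1 pq ler01 f_diff f'_Lp.
have -> : Gamma (1 + 1) * RL_integral a 1 f b =
    \int[lebesgue_measure]_(s in `[a, b]) f s.
  rewrite /RL_integral oner_eq0 GammaD1// Gamma1 invr1 !mul1r.
  by apply: eq_Rintegral => s _; rewrite subrr powRr0 mul1r.
rewrite powRr1 ?(ltW ba0)// (mul1r q) => H1.
set J := Rintegral _ _ _ in H1 *.
set N := Lp_norm_itv _ _ _ _ in Hal H1 *.
have powD r s : (b - a) `^ (r + s) = (b - a) `^ r * (b - a) `^ s.
  by rewrite powRD// (gt_eqF ba0) implybT.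
have -> : Gamma (alpha + 1) * RL_integral a alpha f b - (b - a) `^ (alpha - 1) * J
  = (Gamma (alpha + 1) * RL_integral a alpha f b - (b - a) `^ alpha * f a)
    - (b - a) `^ (alpha - 1) * (J - (b - a) * f a).
  have -> : (b - a) `^ alpha = (b - a) `^ (alpha - 1) * (b - a).
    by rewrite -[in X in _ = _ * X](@powRr1 _ (b - a)) ?(ltW ba0)// -powD subrK.
  by ring.
apply: le_trans (ler_normB _ _) _.
rewrite normrM (ger0_norm (powR_ge0 _ _)).
have -> : (b - a) `^ (alpha + 1 / q)
     * (1 / (alpha * q + 1) `^ (1 / q) + 1 / (q + 1) `^ (1 / q)) * N =
  (b - a) `^ (alpha + 1 / q) / (alpha * q + 1) `^ (1 / q) * N +
  (b - a) `^ (alpha - 1) * ((b - a) `^ (1 + 1 / q) / (q + 1) `^ (1 / q) * N).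
  rewrite mulrA [X in _ + X * N]mulrA -powD addrA subrK.
  by rewrite !mul1r mulrDr mulrDl.
by rewrite lerD// ler_wpM2l// powR_ge0.
Qed.
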